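(* Let $\Gamma_1^\Theta=\langle\Gamma_{\mathcal{W}},S,T\rangle$ and $\Gamma_2^\Theta=\langle\Gamma_{\mathcal{W}},RS,ST\rangle$ be the orbifold fundamental groups of the orbifolds $\Theta_1(2,2,3)$ and $\Theta_2(2,2,3)$, respectively. Then $[\Gamma_1^\Theta,\Gamma_1^\Theta]=[\Gamma_2^\Theta,\Gamma_2^\Theta]=\Gamma_{\mathcal{O}}^1$.
   Context: The Weeks manifold $\mathcal{W}$ is the unique closed orientable hyperbolic $3$-manifold of minimal volume; $\mathcal{W}=\mathbb{H}^3/\Gamma_{\mathcal{W}}$ with $$\Gamma_{\mathcal{W}}=\pi_1(\mathcal{W})=\langle a,b \mid a^2b^2a^2=ba^{-1}b,\ b^2a^2b^2=ab^{-1}a\rangle .$$ It is arithmetic. Let $k$ be the cubic field of discriminant $-23$, $B_{\mathcal{W}}$ the quaternion algebra over $k$ ramified at the real place and at the prime of norm $5$, $\mathcal{O}$ a maximal order in $B_{\mathcal{W}}$, $\Gamma_{\mathcal{O}}^1<\operatorname{PSL}_2(\mathbb{C})$ the image of the group of (norm-one) units of $\mathcal{O}$, and $\Gamma_{\mathcal{O}}$ the normalizer of $\Gamma_{\mathcal{O}}^1$ in $\operatorname{PSL}_2(\mathbb{C})$. Background facts: $\Gamma_{\mathcal{W}}$ is normal of index $12$ in $\Gamma_{\mathcal{O}}$ and $\Gamma_{\mathcal{O}}/\Gamma_{\mathcal{W}}=\operatorname{Isom}(\mathcal{W})\cong D_6$ (dihedral of order $12$). The group $\Gamma_{\mathcal{O}}$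 is generated by $\Gamma_{\mathcal{W}}$ and elements $R,S,T$ with $RaR^{-1}=a^{-1}$, $RbR^{-1}=b^{-1}$, $SaS^{-1}=b$, $SbS^{-1}=a$, $TaT^{-1}=a$, $TbT^{-1}=a^{-1}b^{-1}$ and $R^2=S^2=(RS)^2=(RT)^2=(ST)^3=1$, $T^2=a^{-1}$. In these terms $\Gamma_{\mathcal{O}}^1=\langle\Gamma_{\mathcal{W}},ST\rangle$, which contains $\Gamma_{\mathcal{W}}$ with index $3$. The orbifolds $\Theta_1(2,2,3)$ and $\Theta_2(2,2,3)$ (notation of Mednykh and Vesnin) are the quotients of $\mathcal{W}$ by the two non-conjugate copies of $S_3$ in $\operatorname{Isom}(\mathcal{W})\cong D_6$ generated by the images of $S,T$ and of $RS,ST$, respectively.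
   Formalization: The context's presentation and the action of T cannot hold for the same a, b (they fit after replacing b by its inverse in the presentation); here the presentation is required for some generating pair x, y, and the R, S, T relations for a generating pair a, b, not assumed equal. *)

(* Defs.v *)
From HB Require Import structures.
From mathcomp Require Import all_boot all_order all_algebra.
From mathcomp Require Import falgebra fieldext generic_quotient.
From mathcomp Require Import boolp classical_sets reals.
From mathcomp Require Import complex.

Set Implicit Arguments.
Unset Strict Implicit.
Unset Printing Implicit Defensive.

Import Order.TTheory GRing.Theory Num.Theory.

Local Open Scope quotient_scope.
Local Open Scope classical_set_scope.
Local Open Scope ring_scope.

(** * Subgroups of an arbitrary, possibly infinite, group *)

Section Groups.
Variable G : groupType.
Implicit Types (A H N : set G) (x y g : G).
Local Open Scope group_scope.

Definition subgroup H : Prop :=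
  H 1 /\ forall x y, H x -> H y -> H (x * y^-1).

Definition gen A : set G := smallest subgroup A.

Definition derived H : set G := gen [set [~ x, y] | x in H & y in H].

Definition normalizer H : set G := [set g | [set g * x * g^-1 | x in H] = H].

Definition normal_in N H : Prop := N `<=` H /\ H `<=` normalizer N.

Definition has_index N H (n : nat) : Prop :=
  N `<=` H /\
  exists2 r : 'I_n -> G, (forall i, H (r i)) &
    forall g, H g -> exists! i, N ((r i)^-1 * g).

Definition quotient_iso H N (Q : groupType) : Prop :=
  normal_in N H /\
  exists f : G -> Q,
    [/\ forall x y, H x -> H y -> f (x * y) = f x * f y,
        forall q, exists2 x, H x & f x = q
      & forall x, H x -> f x = 1 <-> N x].

End Groups.

(** * The abstract fundamental group of the Weeks manifold *)

Definition weeks_relations (G : groupType) (x y : G) : Prop :=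
  (x ^+ 2 * y ^+ 2 * x ^+ 2 = y * x^-1 * y /\
   y ^+ 2 * x ^+ 2 * y ^+ 2 = x * y^-1 * x)%g.

(* W has the presentation <x, y | weeks_relations x y>, in the form of von
   Dyck's universal property.  The presenting generators are existentially
   quantified and need not be the generators a, b on which the isometries
   R, S, T of the Weeks manifold act by the formulas
     R : a, b |-> a^-1, b^-1    S : a, b |-> b, a    T : a, b |-> a, a^-1 b^-1.
   Indeed T is not compatible with weeks_relations a b, whereas all three are
   compatible with weeks_relations a b^-1. *)
Definition weeks_presented (G : groupType) (W : set G) : Prop :=
  exists x y : G,
    [/\ W = gen [set x; y], weeks_relations x y &
        forall (H : groupType) (u v : H), weeks_relations u v ->
          exists f : G -> H,
            [/\ forall g h, W g -> W h -> f (g * h)%g = (f g * f h)%g,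
                f x = u & f y = v]].

(** * [SL_2] and [PSL_2] *)

Section SL2.
Variable F : fieldType.

Record SL2 := MkSL2 { sl2val :> 'M[F]_2; sl2valP : \det sl2val == 1 }.

HB.instance Definition _ := [isSub for sl2val].
HB.instance Definition _ := [Choice of SL2 by <:].

Implicit Types A B : SL2.

Fact sl2_one_subproof : \det (1%:M : 'M[F]_2) == 1.
Proof. by rewrite det1. Qed.

Fact sl2_mul_subproof A B : \det (sl2val A *m sl2val B) == 1.
Proof. by rewrite det_mulmx (eqP (sl2valP A)) (eqP (sl2valP B)) mulr1. Qed.

Fact sl2_inv_subproof A : \det (invmx (sl2val A)) == 1.
Proof. by rewrite det_inv (eqP (sl2valP A)) invr1. Qed.

Fact sl2_opp_subproof A : \det (- sl2val A) == 1.
Proof. by rewrite -scaleN1r detZ sqrrN expr1n mul1r sl2valP. Qed.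

Definition sl2_one := MkSL2 sl2_one_subproof.
Definition sl2_mul A B := MkSL2 (sl2_mul_subproof A B).
Definition sl2_inv A := MkSL2 (sl2_inv_subproof A).
Definition sl2_opp A := MkSL2 (sl2_opp_subproof A).

Lemma sl2_unit A : sl2val A \in unitmx.
Proof. by rewrite unitmxE (eqP (sl2valP A)) unitr1. Qed.

Fact sl2_mulA : associative sl2_mul.
Proof. by move=> A B C; apply: val_inj; rewrite /= mulmxA. Qed.
Fact sl2_mul1 : left_id sl2_one sl2_mul.
Proof. by move=> A; apply: val_inj; rewrite /= mul1mx. Qed.
Fact sl2_1mul : right_id sl2_one sl2_mul.
Proof. by move=> A; apply: val_inj; rewrite /= mulmx1. Qed.
Fact sl2_mulV : left_inverse sl2_one sl2_inv sl2_mul.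
Proof. by move=> A; apply: val_inj; rewrite /= mulVmx // sl2_unit. Qed.
Fact sl2_Vmul : right_inverse sl2_one sl2_inv sl2_mul.
Proof. by move=> A; apply: val_inj; rewrite /= mulmxV // sl2_unit. Qed.

HB.instance Definition _ :=
  isGroup.Build SL2 sl2_mulA sl2_mul1 sl2_1mul sl2_mulV sl2_Vmul.

Definition psl2_rel A B : bool := (A == B) || (A == sl2_opp B).

Fact sl2_oppK : involutive sl2_opp.
Proof. by move=> A; apply: val_inj; rewrite /= opprK. Qed.

Fact psl2_rel_equiv : equiv_class_of psl2_rel.
Proof.
split=> [A|A B|B A C]; rewrite /psl2_rel.
- by rewrite eqxx.
- by rewrite eq_sym; congr orb; rewrite [LHS]eq_sym (can2_eq sl2_oppK sl2_oppK).
- case/orP=> /eqP->; case/orP=> /eqP->;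
    by rewrite ?sl2_oppK eqxx ?orbT.
Qed.

Canonical psl2_equiv := EquivRelPack psl2_rel_equiv.
Canonical psl2_encModRel := defaultEncModRel psl2_rel.

Definition PSL2 := {eq_quot psl2_rel}.

HB.instance Definition _ := Choice.on PSL2.

Definition psl2_pi (A : SL2) : PSL2 := \pi_PSL2 A.

Lemma psl2_piP A B : psl2_pi A = psl2_pi B <-> A = B \/ A = sl2_opp B.
Proof.
split; first by move/eqquotP/orP=> [] /eqP->; [left | right].
by case=> ->; apply/eqquotP; rewrite /= /psl2_rel eqxx ?orbT.
Qed.

Lemma psl2_surj (g : PSL2) : exists A, psl2_pi A = g.
Proof. by exists (repr g); rewrite /psl2_pi reprK. Qed.

Definition psl2_one : PSL2 := psl2_pi 1%g.
Definition psl2_mul (g h : PSL2) : PSL2 := psl2_pi (repr g * repr h)%g.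
Definition psl2_inv (g : PSL2) : PSL2 := psl2_pi (repr g)^-1%g.

Lemma psl2_repr A : repr (psl2_pi A) = A \/ repr (psl2_pi A) = sl2_opp A.
Proof. by apply/psl2_piP; rewrite /psl2_pi reprK. Qed.

Lemma psl2_mulE A B : psl2_mul (psl2_pi A) (psl2_pi B) = psl2_pi (A * B)%g.
Proof.
apply/psl2_piP; case: (psl2_repr A) => ->; case: (psl2_repr B) => ->;
  [left|right|right|left]; apply: val_inj => //=.
- by rewrite mulmxN.
- by rewrite mulNmx.
- by rewrite mulmxN mulNmx opprK.
Qed.

Lemma psl2_invE A : psl2_inv (psl2_pi A) = psl2_pi A^-1%g.
Proof.
apply/psl2_piP; case: (psl2_repr A) => ->; [by left | right].
apply: val_inj => /=; apply: (can_inj (mulmxK (sl2_unit A))).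
rewrite mulNmx mulVmx ?sl2_unit // -[X in _ *m X]opprK mulmxN mulVmx //.
exact: sl2_unit (sl2_opp A).
Qed.

Fact psl2_mulA : associative psl2_mul.
Proof.
move=> x y z; case: (psl2_surj x) (psl2_surj y) (psl2_surj z) => A <- [B <-] [C <-].
by rewrite !psl2_mulE mulgA.
Qed.
Fact psl2_mul1 : left_id psl2_one psl2_mul.
Proof. by move=> x; case: (psl2_surj x) => A <-; rewrite psl2_mulE mul1g. Qed.
Fact psl2_1mul : right_id psl2_one psl2_mul.
Proof. by move=> x; case: (psl2_surj x) => A <-; rewrite psl2_mulE mulg1. Qed.
Fact psl2_mulV : left_inverse psl2_one psl2_inv psl2_mul.
Proof.
by move=> x; case: (psl2_surj x) => A <-; rewrite psl2_invE psl2_mulE mulVg.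
Qed.
Fact psl2_Vmul : right_inverse psl2_one psl2_inv psl2_mul.
Proof.
by move=> x; case: (psl2_surj x) => A <-; rewrite psl2_invE psl2_mulE mulgV.
Qed.

HB.instance Definition _ :=
  isGroup.Build PSL2 psl2_mulA psl2_mul1 psl2_1mul psl2_mulV psl2_Vmul.

End SL2.

(** * Closed hyperbolic 3-manifold groups in [PSL_2(C)] *)

Section Kleinian.
Variable RR : realType.
Local Notation C := RR[i].
Implicit Types W : set (PSL2 C).

Definition discrete W : Prop :=
  exists2 e : C, 0 < e &
    forall A : SL2 C, W (psl2_pi A) ->
      (forall i j, `|sl2val A i j - (1%:M : 'M[C]_2) i j| < e) ->
      psl2_pi A = 1%g.

Definition torsion_free W : Prop :=
  forall g n, W g -> (g ^+ n.+1)%g = 1%g -> g = 1%g.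

(* The sets of matrices of SL_2(C) with bounded entries are relatively
   compact, so W is cocompact iff its translates of one of them cover. *)
Definition cocompact W : Prop :=
  exists M : C, forall g : PSL2 C, exists w : PSL2 C, exists A : SL2 C,
    [/\ W w, g = (w * psl2_pi A)%g & forall i j, `|sl2val A i j| <= M].

(* The quotient of hyperbolic 3-space by W is the Weeks manifold: W acts
   freely, properly discontinuously and cocompactly, and it is isomorphic to
   the fundamental group of the Weeks manifold, which determines the quotient
   up to isometry by Mostow rigidity. *)
Definition weeks_group W : Prop :=
  [/\ subgroup W, discrete W, torsion_free W, cocompact W & weeks_presented W].

End Kleinian.

(** * Number fields *)

Section NumberField.
Variable k : fieldExtType rat.

Definition ring_of_integers : set k := [set x | integralOver (intr : int -> k) x].

Definition field_trace n (e : n.-tuple k) (x : k) : rat :=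
  \tr (\matrix_(i < n, j < n) coord e j (x * e`_i)).

Definition integral_basis n (e : n.-tuple k) : Prop :=
  basis_of {:k} e /\
  forall x, ring_of_integers x <-> forall i, coord e i x \is a Num.int.

Definition field_discriminant (d : rat) : Prop :=
  exists n (e : n.-tuple k), integral_basis e /\
    \det (\matrix_(i < n, j < n) field_trace e (e`_i * e`_j)) = d.

End NumberField.

(** * Places, as nontrivial absolute values *)

Section Places.
Variables (RR : realType) (k : fieldType).
Implicit Types v w : k -> RR.

Definition absolute_value v : Prop :=
  [/\ forall x, 0 <= v x,
      forall x, v x = 0 <-> x = 0,
      forall x y, v (x * y) = v x * v y
    & forall x y, v (x + y) <= v x + v y].

Definition nontrivial_abs v : Prop := exists2 x, x != 0 & v x != 1.

Definition equivalent_abs v w : Prop := forall x, v x < 1 <-> w x < 1.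

Definition real_place v : Prop :=
  exists tau : {rmorphism k -> RR}, equivalent_abs v (fun x => `|tau x|).

(* A finite place whose residue field has q elements, of which r is a system
   of representatives. *)
Definition prime_of_norm (q : nat) v : Prop :=
  (forall x y, v (x + y) <= Num.max (v x) (v y)) /\
  exists r : 'I_q -> k,
    (forall i, v (r i) <= 1) /\
    (forall x, v x <= 1 -> exists! i, v (x - r i) < 1).

End Places.

(** * Quaternion algebras *)

Section Completion.
Variables (RR : realType) (k : fieldType) (B : falgType k) (v : k -> RR).
Implicit Types u w : nat -> B.

(* The elements of the completion of B at v, which is the tensor product of B
   with the completion of k, are represented by the sequences in B that are
   Cauchy coordinatewise, two of them being identified when their difference
   is null. *)
Definition null_seq u : Prop :=
  forall i (e : RR), 0 < e -> exists N : nat, forall n, (N <= n)%N ->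
    v (coord (vbasis {:B}) i (u n)) < e.

Definition cauchy_seq u : Prop :=
  forall i (e : RR), 0 < e ->
    exists N : nat, forall m n, (N <= m)%N -> (N <= n)%N ->
      v (coord (vbasis {:B}) i (u m - u n)) < e.

(* The completion of B at v is a division algebra. *)
Definition ramified_at : Prop :=
  forall u, cauchy_seq u -> ~ null_seq u ->
    exists2 w, cauchy_seq w &
      null_seq (fun n => u n * w n - 1) /\ null_seq (fun n => w n * u n - 1).

End Completion.

Section Quaternion.
Variables (k : fieldType) (B : falgType k).

Definition quaternion_tuple (qi qj : B) : 4.-tuple B :=
  [tuple 1; qi; qj; qi * qj].

(* B is the quaternion algebra (alpha, beta / k), with standard generators
   qi and qj. *)
Definition quaternion_algebra (alpha beta : k) (qi qj : B) : Prop :=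
  [/\ (2%:R != 0 :> k) /\ (alpha != 0 /\ beta != 0),
      basis_of {:B} (quaternion_tuple qi qj),
      qi ^+ 2 = alpha%:A, qj ^+ 2 = beta%:A & qj * qi = - (qi * qj)].

Definition reduced_norm (alpha beta : k) (qi qj x : B) : k :=
  let c n := coord (quaternion_tuple qi qj) (inord n) x in
  c 0%N ^+ 2 - alpha * c 1%N ^+ 2 - beta * c 2%N ^+ 2
    + alpha * beta * c 3%N ^+ 2.

End Quaternion.

Section Orders.
Variables (k : fieldExtType rat) (B : falgType k).
Implicit Type O : set B.

Definition is_order O : Prop :=
  [/\ O 1, forall x y, O x -> O y -> O (x - y),
      forall x y, O x -> O y -> O (x * y)
    & exists n (s : n.-tuple B), <<s>>%VS = fullv /\
        O = [set \sum_(i < n) c i *: s`_i | c in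
              [set c : 'I_n -> k | forall i, ring_of_integers (c i)]]].

Definition maximal_order O : Prop :=
  is_order O /\ forall O', is_order O' -> O `<=` O' -> O' = O.

End Orders.

(** * The arithmetic group of a maximal order *)

Section Arithmetic.
Variables (RR : realType) (k : fieldExtType rat) (B : falgType k).
Local Notation C := RR[i].

Definition complex_place (sigma : {rmorphism k -> C}) : Prop :=
  exists x, sigma x \isn't Num.real.

(* rho identifies the tensor product of B with C over sigma with M_2(C). *)
Definition matrix_splitting (sigma : {rmorphism k -> C})
    (rho : {rmorphism B -> 'M[C]_2}) : Prop :=
  forall c x, rho (c *: x) = sigma c *: rho x.

Definition norm_one_group (alpha beta : k) (qi qj : B) (O : set B)
    (rho : {rmorphism B -> 'M[C]_2}) : set (PSL2 C) :=
  [set psl2_pi A | A in [set A : SL2 C | exists x : B,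
     [/\ O x, reduced_norm alpha beta qi qj x = 1 & sl2val A = rho x]]].

End Arithmetic.

(* Main.v *)
(* The group GammaO1 is a monoid containing GammaW with finite index, hence a
   subgroup.  Its image in GammaO / GammaW = D_6 is normal of order 3, with a
   quotient of order 4, hence abelian: this gives [GammaO, GammaO] <= GammaO1,
   and shows that every element of order 3 of GammaO is in GammaO1.  As GammaW
   is torsion-free, ST is not in GammaW (otherwise S = T, a = b = 1, and
   GammaO = <R, S> has exponent 2), so GammaO1 = <GammaW, ST>.  It remains to
   see that a, b and ST die in the abelianizations.
   - In <GammaW, S, T>: S gives a = b and T gives a b^2 = 1, so a^3 = 1, whereas
     the Weeks relations give the abelianization of GammaW exponent 5.  Hence
     a = b = 1, and (ST)^3 = 1 becomes ST = 1 since S^2 = 1 and T^2 = a^-1.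
   - In <GammaW, RS, ST>: RS gives a = b^-1, ST gives a b^2 = 1, so a = b = 1;
     and RS inverts ST, which has order 3. *)
Require Import Defs.
From HB Require Import structures.
From mathcomp Require Import all_boot all_order all_algebra.
From mathcomp Require Import fingroup extremal falgebra fieldext.
From mathcomp Require Import boolp classical_sets reals.
From mathcomp Require Import complex.
From mathcomp Require Import quotient cyclic pgroup sylow commutator.
From mathcomp Require Import zify ring.

Set Implicit Arguments.
Unset Strict Implicit.
Unset Printing Implicit Defensive.

Import Order.TTheory GRing.Theory Num.Theory.

Local Open Scope classical_set_scope.
Local Open Scope ring_scope.

(** * Subgroups, commutator subgroups and finite quotients *)

Section Subgroups.
Variable G : groupType.
Implicit Types (A H N : set G) (x y g : G).
Local Open Scope group_scope.

Lemma subgroupV H x : subgroup H -> H x -> H x^-1.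
Proof. by case=> H1 HB Hx; rewrite -[x^-1]mul1g; apply: HB. Qed.

Lemma subgroupM H x y : subgroup H -> H x -> H y -> H (x * y).
Proof.
move=> sH Hx Hy; rewrite -[y]invgK; apply: sH.2 => //; exact: subgroupV.
Qed.

Lemma subgroupX H x n : subgroup H -> H x -> H (x ^+ n).
Proof.
move=> sH Hx; elim: n => [|n IHn]; first exact: sH.1.
by rewrite expgS; apply: subgroupM.
Qed.

Lemma subgroupR H x y : subgroup H -> H x -> H y -> H [~ x, y].
Proof.
by move=> sH Hx Hy; rewrite /commg /conjg; do !apply: subgroupM => //;
  apply: subgroupV.
Qed.

Lemma subgroup_gen A : subgroup (gen A).
Proof.
split=> [B [[] //]|x y Ax Ay B sB].
by apply: sB.1.2; [apply: Ax | apply: Ay].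
Qed.

Lemma sub_gen A : A `<=` gen A.
Proof. exact: sub_gen_smallest. Qed.

Lemma gen_sub A H : subgroup H -> A `<=` H -> gen A `<=` H.
Proof. exact: smallest_sub. Qed.

Lemma normalizerP N g : normalizer N g -> forall x, N (g * x * g^-1) <-> N x.
Proof.
move=> nNg x; split=> [|Nx]; last by rewrite -[X in X _]nNg; exists x.
by rewrite -{1}nNg => -[y Ny /mulIg/mulgI <-].
Qed.

Lemma subgroup_sub_normalizer H : subgroup H -> H `<=` normalizer H.
Proof.
move=> sH g Hg; apply/seteqP; split=> [_ [x Hx <-]|x Hx].
  by apply: sH.2 => //; apply: subgroupM.
exists (g^-1 * x * g); last by rewrite -!mulgA mulgV mulg1 mulVKg.
by do !apply: subgroupM => //; apply: subgroupV.
Qed.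

Lemma derivedS H1 H2 : H1 `<=` H2 -> derived H1 `<=` derived H2.
Proof.
move=> sH12; apply: gen_sub; first exact: subgroup_gen.
by move=> _ [x Hx [y Hy <-]]; apply: sub_gen; exists x; [|exists y]; auto.
Qed.

(** The products differ by a commutator: [y * x = x * y * [~ y, x]]. This allows a word to be
    rotated cyclically. *)
Lemma derived_conj H x y : subgroup H -> H x -> H y ->
  derived H (x * y) -> derived H (y * x).
Proof.
move=> sH Hx Hy Dxy; rewrite -[y * x](mulKVg (x * y)).
apply: subgroupM (subgroup_gen _) Dxy _; apply: sub_gen.
exists y => //; exists x => //.
by rewrite /commg /conjg invMg !mulgA.
Qed.

(* Computing in the abelianization of H without forming the quotient. *)
Lemma derived_prod_perm H (s t : seq G) : subgroup H ->
  all (fun x => `[< H x >]) s -> perm_eq s t ->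
  derived H (\prod_(x <- s) x) -> derived H (\prod_(x <- t) x).
Proof.
move=> sH sHs st Ds.
suff Dst: derived H ((\prod_(x <- s) x)^-1 * \prod_(x <- t) x).
  rewrite -[X in derived _ X](mulKVg (\prod_(x <- s) x)).
  exact: subgroupM (subgroup_gen _) _ _.
have Hprod r : all (fun x => `[< H x >]) r -> H (\prod_(x <- r) x).
  elim: r => [_|x r IHr /= /andP[/asboolP Hx /IHr Hr]].
    by rewrite big_nil; exact: sH.1.
  by rewrite big_cons; apply: subgroupM.
elim: s t sHs st {Ds} => [|x s IHs] t /= sHs st.
  move: st; rewrite perm_sym => /perm_nilP->; rewrite big_nil invg1 mulg1.
  exact: (subgroup_gen _).1.
have xt: x \in t by rewrite -(perm_mem st) mem_head.
have Ht: all (fun x => `[< H x >]) t by rewrite -(perm_all _ st).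
case/splitPr: xt st Ht => t1 t2.
rewrite perm_sym -cat1s perm_catCA /= perm_cons perm_sym => st.
rewrite all_cat /= => /and3P[/Hprod Hp1 _ /Hprod Hp2].
case/andP: sHs => /asboolP Hx sHs.
have := IHs _ sHs st; have := Hprod _ sHs; rewrite !big_cat !big_cons /=.
set ps := \prod_(i <- s) i; set p1 := \prod_(i <- t1) i in Hp1 *.
set p2 := \prod_(i <- t2) i in Hp2 * => Hps D1.
have Hps' := subgroupV sH Hps; have Hx' := subgroupV sH Hx.
have Hc: H (x^-1 * p1 * x) by do !apply: subgroupM => //.
(* The letter [x] disappears at the price of conjugating [p1]. Rotating [p2] to the front lets
   [[~ p1, x]] split off at the end, and rotating back leaves the induction hypothesis [D1]. *)
have ->: (x * ps)^-1 * (p1 * (x * p2)) = (ps^-1 * (x^-1 * p1 * x)) * p2.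
  by rewrite invMg !mulgA.
apply: derived_conj => //; first by apply: subgroupM.
have ->: p2 * (ps^-1 * (x^-1 * p1 * x)) = (p2 * ps^-1 * p1) * [~ p1, x].
  by rewrite /commg /conjg -!mulgA mulKVg.
apply: subgroupM (subgroup_gen _) _ _; last first.
  by apply: sub_gen; exists p1 => //; exists x.
rewrite -mulgA; apply: derived_conj => //; last by rewrite -mulgA.
exact: subgroupM.
Qed.

(* In a monoid containing N with finite index, some power of each element is
   in N by the pigeonhole principle. *)
Lemma subgroup_of_finite_index N H n : subgroup N ->
  (forall x y, H x -> H y -> H (x * y)) -> has_index N H n -> subgroup H.
Proof.
move=> sN HM [sNH [r Hr rP]]; have H1: H 1 by apply: sNH; exact: sN.1.
have HX x m: H x -> H (x ^+ m).
  by move=> Hx; elim: m => // m IHm; rewrite expgS; apply: HM.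
suff HV x: H x -> H x^-1 by split=> // x y Hx /HV Hy; apply: HM.
move=> Hx.
have /choice[c cP]: forall m : nat, exists i : 'I_n, N ((r i)^-1 * x ^+ m).
  by move=> m; case: (rP (x ^+ m) (HX x m Hx)) => i [Ni _]; exists i.
have /injectivePn[i [j ij cij]]: ~~ injectiveb (fun i : 'I_n.+1 => c i).
  apply/negP=> /injectiveP/(leq_card _); rewrite !card_ord; lia.
wlog lt_ij: i j ij cij / (i < j)%N.
  move=> wl; case: (ltngtP i j) => [|lt_ji|/val_inj eij]; first exact: wl.
    by apply: (wl j i) => //; rewrite eq_sym.
  by rewrite eij eqxx in ij.
have Nij: N (x ^+ (j - i)).
  rewrite -[x ^+ _](mulKg ((r (c i))^-1 * x ^+ i)).
  apply: subgroupM => //; first by apply: subgroupV.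
  by rewrite -mulgA -expgnDr subnKC ?(ltnW lt_ij) // cij.
(* The first factor is in the monoid [H]; the second is the inverse of an element of the group
   [N]. *)
have ->: x^-1 = x ^+ (j - i).-1 * (x ^+ (j - i))^-1.
  have: (0 < j - i)%N by rewrite subn_gt0.
  by case: (j - i)%N => // m _; rewrite expgS invMg mulKVg.
by apply: HM; [apply: HX | apply: sNH; apply: subgroupV].
Qed.

End Subgroups.

(** * Images of subgroups in a finite quotient *)

Section FiniteQuotient.
Variables (G : groupType) (L N : set G) (Q : finGroupType) (f : G -> Q).
Hypothesis sL : subgroup L.
Hypothesis fM : forall x y, L x -> L y -> f (x * y)%g = (f x * f y)%g.
Hypothesis fN : forall x, L x -> f x = 1%g <-> N x.
Implicit Types (H : set G) (x y : G).
Local Open Scope group_scope.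

Definition quotient_image H : {set Q} := [set q | `[< (f @` H) q >]]%SET.

Lemma quotient_imageP H q : reflect ((f @` H) q) (q \in quotient_image H).
Proof. by rewrite inE; apply: asboolP. Qed.

Lemma quotient_map1 : f 1 = 1.
Proof. by apply: (mulgI (f 1)); rewrite -fM ?mulg1 //; apply: sL.1. Qed.

Lemma quotient_mapV x : L x -> f x^-1 = (f x)^-1.
Proof.
move=> Lx; apply: (mulgI (f x)).
by rewrite -fM ?mulgV ?quotient_map1 //; apply: subgroupV.
Qed.

Lemma quotient_mapX x n : L x -> f (x ^+ n) = f x ^+ n.
Proof.
move=> Lx; elim: n => [|n IHn]; first exact: quotient_map1.
by rewrite !expgS fM ?IHn //; apply: subgroupX.
Qed.

Lemma quotient_mapR x y : L x -> L y -> f [~ x, y] = [~ f x, f y].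
Proof.
move=> Lx Ly; have Lx' := subgroupV sL Lx; have Ly' := subgroupV sL Ly.
by rewrite /commg /conjg !fM ?quotient_mapV //; do !apply: subgroupM.
Qed.

Lemma quotient_map_eq x y : L x -> L y -> f x = f y <-> N (x^-1 * y).
Proof.
move=> Lx Ly; have Lx' := subgroupV sL Lx.
rewrite -fN ?fM ?quotient_mapV //; last exact: subgroupM.
split=> [->|]; first by rewrite mulVg.
by move=> fxy; apply: (mulgI (f x)^-1); rewrite mulVg.
Qed.

Lemma group_set_quotient_image H : subgroup H -> H `<=` L ->
  group_set (quotient_image H).
Proof.
move=> sH sHL; apply/group_setP; split=> [|q1 q2 /quotient_imageP[x Hx <-]].
  by apply/quotient_imageP; exists 1; [exact: sH.1 | exact: quotient_map1].
move=> /quotient_imageP[y Hy <-]; apply/quotient_imageP; exists (x * y).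
  exact: subgroupM.
by rewrite fM //; apply: sHL.
Qed.

(** On [H] the fibres of [f] are the left cosets of [N], so [f] maps the representatives [r]
    bijectively onto the image. *)
Lemma card_quotient_image H n : N 1 -> H `<=` L -> has_index N H n ->
  #|quotient_image H| = n.
Proof.
move=> N1 sHL [_ [r Hr rP]].
have finj: injective (f \o r).
  move=> i j /= /(quotient_map_eq (sHL _ (Hr i)) (sHL _ (Hr j))) Nij.
  case: (rP _ (Hr j)) => l [_ uniq_l].
  by rewrite -(uniq_l i Nij) (uniq_l j) ?mulVg.
rewrite -[RHS]card_ord -cardsT -(card_imset _ finj); apply: eq_card => q.
apply/quotient_imageP/imsetP => [[x Hx <-]|[i _ ->]]; last by exists (r i).
case: (rP _ Hx) => i [Ni _]; exists i => //=; symmetry.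
by apply/(quotient_map_eq (sHL _ (Hr i)) (sHL _ Hx)).
Qed.

End FiniteQuotient.

(** * The norm-one group is closed under multiplication *)

Section ReducedNorm.
Variables (k : fieldType) (B : falgType k) (alpha beta : k) (qi qj : B).
Hypothesis hB : quaternion_algebra alpha beta qi qj.

Let q4 (c0 c1 c2 c3 : k) : B :=
  c0 *: 1 + c1 *: qi + c2 *: qj + c3 *: (qi * qj).

Lemma reduced_normE c0 c1 c2 c3 :
  reduced_norm alpha beta qi qj (q4 c0 c1 c2 c3) =
  c0 ^+ 2 - alpha * c1 ^+ 2 - beta * c2 ^+ 2 + alpha * beta * c3 ^+ 2.
Proof.
case: hB => _ /andP[_ fB] _ _ _.
have ->: q4 c0 c1 c2 c3 =
    \sum_(i < 4) [:: c0; c1; c2; c3]`_i *: (quaternion_tuple qi qj)`_i.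
  by rewrite !big_ord_recr big_ord0 /= add0r.
by rewrite /reduced_norm !coord_sum_free // !inordK.
Qed.

Lemma quaternion_decomposition x : exists c0 c1 c2 c3, x = q4 c0 c1 c2 c3.
Proof.
case: hB => _ bB _ _ _; rewrite (coord_basis bB (memvf x)).
rewrite !big_ord_recr big_ord0 /= add0r /q4.
by do 4!eexists.
Qed.

(** Left multiplication by [qi] and [qj] acts on coordinates by [qiM] and [qjM]. This gives the
    coordinates of the product, and multiplicativity becomes a polynomial identity of four-square
    type. *)
Lemma reduced_normM x y : reduced_norm alpha beta qi qj (x * y) =
  reduced_norm alpha beta qi qj x * reduced_norm alpha beta qi qj y.
Proof.
case: (quaternion_decomposition x) => a0 [a1 [a2 [a3 ->]]].
case: (quaternion_decomposition y) => b0 [b1 [b2 [b3 ->]]].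
have [_ _ ii jj ji] := hB.
have qD c0 c1 c2 c3 d0 d1 d2 d3 : q4 c0 c1 c2 c3 + q4 d0 d1 d2 d3 =
    q4 (c0 + d0) (c1 + d1) (c2 + d2) (c3 + d3).
  rewrite /q4 !scalerDl addrACA; congr (_ + _).
  by rewrite addrACA; congr (_ + _); rewrite addrACA.
have qZ c c0 c1 c2 c3 :
    c *: q4 c0 c1 c2 c3 = q4 (c * c0) (c * c1) (c * c2) (c * c3).
  by rewrite /q4 !scalerDr !scalerA.
have qiM c0 c1 c2 c3 :
    qi * q4 c0 c1 c2 c3 = q4 (alpha * c1) c0 (alpha * c3) c2.
  rewrite /q4 !mulrDr -!scalerAr mulr1 mulrA -expr2 ii mulr_algl !scalerA.
  by rewrite (ACl (2*1*4*3)) /= ![_ * alpha]mulrC.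
have qjM c0 c1 c2 c3 :
    qj * q4 c0 c1 c2 c3 = q4 (beta * c2) (- (beta * c3)) c0 (- c1).
  rewrite /q4 !mulrDr -!scalerAr mulr1 mulrA ji mulNr -mulrA -expr2 jj.
  rewrite mulr_algr !scalerN !scalerA !scaleNr.
  by rewrite (ACl (3*4*1*2)) /= ![_ * beta]mulrC.
have -> y' : q4 a0 a1 a2 a3 * y' =
    a0 *: y' + a1 *: (qi * y') + a2 *: (qj * y') + a3 *: (qi * (qj * y')).
  by rewrite /q4 !mulrDl -!scalerAl mul1r mulrA.
rewrite !(qjM, qiM) !qZ !qD !reduced_normE; ring.
Qed.
End ReducedNorm.

(** Products suffice here: closure under inverses will come from the finite index over [GammaW], by
    [subgroup_of_finite_index]. *)
Lemma norm_one_groupM (RR : realType) (k : fieldExtType rat) (B : falgType k)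
    (alpha beta : k) (qi qj : B) (O : set B) (rho : {rmorphism B -> 'M[RR[i]]_2})
    (g h : PSL2 RR[i]) :
  quaternion_algebra alpha beta qi qj -> is_order O ->
  norm_one_group alpha beta qi qj O rho g ->
  norm_one_group alpha beta qi qj O rho h ->
  norm_one_group alpha beta qi qj O rho (g * h)%g.
Proof.
move=> hB [_ _ OM _] [A [x [Ox nx Ax]] <-] [A' [y [Oy ny Ay]] <-].
exists (A * A')%g; last by rewrite -psl2_mulE.
exists (x * y); split; first exact: OM.
  by rewrite reduced_normM // nx ny mulr1.
by rewrite rmorphM -Ax -Ay.
Qed.

(** * Normal subgroups of index 4 *)

Section Index12Over3.
Variables (G : groupType) (L H N : set G) (Q : finGroupType).
Hypotheses (sL : subgroup L) (sH : subgroup H) (sN : subgroup N).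
Hypotheses (sHL : H `<=` L) (nHL : L `<=` normalizer H).
Hypotheses (LNQ : quotient_iso L N Q) (oQ : #|[set: Q]%G| = 12%N).
Hypothesis NH3 : has_index N H 3.
Local Open Scope group_scope.

(** [K] is the image of [H] in [Q]. Since [N] lies in [H], membership in [H] can be tested in
    [K]. *)
Let quotient_setup : exists (f : G -> Q) (K : {group Q}),
  [/\ forall x y, L x -> L y -> f (x * y) = f x * f y,
      forall x, L x -> f x = 1 <-> N x,
      forall x, L x -> (f x \in K) <-> H x,
      K <| [set: Q]%G & #|K| = 3%N].
Proof.
have [_ [f [fM fsurj fN]]] := LNQ.
pose K := group (group_set_quotient_image sL fM sH sHL).
have KP x : L x -> (f x \in K) <-> H x.
  move=> Lx; split=> [/quotient_imageP[y Hy fyx]|Hx]; last first.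
    by apply/quotient_imageP; exists x.
  rewrite -[x](mulKVg y); apply: subgroupM => //; apply: NH3.1.
  by apply/(quotient_map_eq sL fM fN _ _) => //; exact: sHL.
exists f, K; split=> //.
  rewrite /normal finset.subsetT; apply/fintype.subsetP=> q _; rewrite inE.
  apply/fintype.subsetP=> _ /imsetP[_ /quotient_imageP[x Hx <-] ->].
  have [g Lg <-] := fsurj q; have Lg' := subgroupV sL Lg; have Lx := sHL Hx.
  have ->: f x ^ f g = f (g^-1 * x * g).
    by rewrite !fM ?(quotient_mapV sL fM) // ?/conjg ?mulgA //; apply: subgroupM.
  apply/KP; first by do !apply: subgroupM.
  (* [normalizer] conjugates by [g * x * g^-1] but [x ^ g] is [g^-1 * x * g], hence the passage to
     [g^-1]. *)
  by rewrite -{2}[g]invgK; apply/(normalizerP (nHL Lg')).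
exact: card_quotient_image (sN.1) sHL NH3.
Qed.

(** The quotient of [Q] by [K] has order 12 / 3 = 4, the square of a prime, so it is abelian. *)
Lemma derived_sub_index3 : derived L `<=` H.
Proof.
have [f [K [fM fN KP nKQ oK]]] := quotient_setup.
apply: gen_sub => // _ [x Lx [y Ly <-]].
apply/(KP _ (subgroupR sL Lx Ly)); rewrite (quotient_mapR sL fM) //.
have: abelian ([set: Q]%G / K).
  by rewrite (@card_p2group_abelian _ 2) // card_quotient ?normal_norm //
    -divgS ?oQ ?oK ?finset.subsetT.
move/(der1_min (normal_norm nKQ))/fintype.subsetP; apply.
by rewrite mem_commg ?inE.
Qed.

(** As 12 / 3 is prime to 3, [K] is a normal Hall 3-subgroup and contains every 3-element of [Q]. *)
Lemma mem_index3_of_expg3 t : L t -> t ^+ 3 = 1 -> H t.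
Proof.
have [f [K [fM fN KP nKQ oK]]] := quotient_setup.
move=> Lt t3; apply/(KP _ Lt).
have hallK: 3.-Hall([set: Q]%G) K.
  by rewrite pHallE finset.subsetT oQ oK p_part.
rewrite (mem_normal_Hall hallK nKQ) ?inE //.
rewrite /p_elt; apply: (@pnat_dvd _ 3); last exact: pnat_id.
by rewrite order_dvdn -(quotient_mapX sL fM) // t3 (quotient_map1 sL fM).
Qed.

(** [f t] is nontrivial in a group of prime order 3, so it generates [K]; each [x] in [H] then
    differs from a power of [t] by an element of [N]. *)
Lemma index3_gen t : H t -> ~ N t -> H `<=` gen (N `|` [set t]).
Proof.
have [f [K [fM fN KP nKQ oK]]] := quotient_setup.
move=> Ht Nt x Hx; have [Lt Lx] := (sHL Ht, sHL Hx).
have ft1 : f t != 1 by apply/eqP => /(fN _ Lt).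
have fK : K :=: <[f t]>.
  apply/esym/eqP; rewrite eqEcard cycle_subG (KP _ Lt).2 //= oK.
  have: (#[f t] %| 3)%N by rewrite -oK order_dvdG // (KP _ Lt).2.
  rewrite (dvdn_divisors _ (isT : 0 < 3)%N) !inE order_eq1 (negPf ft1) /=.
  by rewrite /order => /eqP->.
have: f x \in <[f t]> by rewrite -fK; apply/(KP _ Lx).
case/cycleP=> n fxn; have Ltn := subgroupX n sL Lt.
have sg := subgroup_gen (N `|` [set t]).
rewrite -[x](mulKVg (t ^+ n)); apply: (subgroupM sg).
  apply: (subgroupX n sg); exact: (sub_gen (or_intror erefl)).
apply: (sub_gen (or_introl _)); apply/(quotient_map_eq sL fM fN Ltn Lx).
by rewrite (quotient_mapX sL fM).
Qed.

Lemma exists_expg2_notin : exists2 x, L x & ~ N (x ^+ 2).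
Proof.
have [_ [f [fM fsurj fN]]] := LNQ.
have [|q _ oq] := @Cauchy _ 3 [set: Q]%G isT; first by rewrite oQ.
have [x Lx fx] := fsurj q; exists x => // /(fN _ (subgroupX 2 sL Lx)).
by rewrite (quotient_mapX sL fM) // fx => /eqP; rewrite -order_dvdn oq.
Qed.

End Index12Over3.

(** * Relations in the abelianization *)

Section Words.
Variable G : groupType.
Implicit Types (H : set G) (a b x y : G).
Local Open Scope group_scope.

(** Written additively, the first relation reads 4x + 2y = 2y - x, so 5x = 0, and the second gives
    5y = 0. The claim covers every word [w] because it is later applied to [a], which need not be a
    presenting generator. *)
Lemma weeks_derived_exp5 H x y w : subgroup H -> H x -> H y ->
  weeks_relations x y -> gen [set x; y] w -> derived H (w ^+ 5).
Proof.
move=> sH Hx Hy [xy yx].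
have sD := subgroup_gen [set [~ u, v] | u in H & v in H].
have step u v : H u -> H v ->
    u ^+ 2 * v ^+ 2 * u ^+ 2 = v * u^-1 * v -> derived H (u ^+ 5).
  move=> Hu Hv uv; have Hu' := subgroupV sH Hu; have Hv' := subgroupV sH Hv.
  (* The first word is the left side of the relation times the inverse of the right side, hence
     trivial; the second collapses to [u ^+ 5]. *)
  have := @derived_prod_perm _ H [:: u; u; v; v; u; u; v^-1; u; v^-1]
    [:: u; u; u; u; u; v; v^-1; v; v^-1] sH.
  rewrite /= !asboolT // => /(_ isT); rewrite !big_cons !big_nil => D.
  rewrite !expgS expg0; move: D; rewrite !(mulg1, mulgV); apply.
    by apply/permP=> p /=; lia.
  rewrite !mulgA -[_ * u * u]mulgA -[u * u * v * v]mulgA -!expg2 uv.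
  by rewrite -!mulgA mulKVg mulKg mulgV; exact: sD.1.
suff: gen [set x; y] `<=` [set w | H w /\ derived H (w ^+ 5)] by move=> h /h[].
apply: gen_sub => [|_ [->|->]]; last 2 first.
- by split=> //; apply: step xy.
- by split=> //; apply: step yx.
split=> [|u v [Hu Du] [Hv Dv]].
  by split; [exact: sH.1 | rewrite expg1n; exact: sD.1].
have Hv' := subgroupV sH Hv; split; first exact: sH.2.
have := @derived_prod_perm _ H (nseq 5 u ++ nseq 5 v^-1)
  (flatten (nseq 5 [:: u; v^-1])) sH.
rewrite /= !asboolT // !big_cons !big_nil !mulg1 => D.
rewrite !expgS expg0 mulg1 -!mulgA; apply: D => //.
  by apply/permP=> p /=; lia.
have := sD.2 _ _ Du Dv; rewrite -expVgn.
by rewrite !expgS !expg0 !mulg1 -!mulgA.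
Qed.
End Words.

(** * Abelianizations of the two orbifold groups *)

Section Abelianizations.
Variable G : groupType.
Implicit Types (H : set G) (a b g x y S T u v : G).
Local Open Scope group_scope.

Lemma derived_conj_eq H g x y : subgroup H -> H g -> H x ->
  g * x * g^-1 = y -> derived H (x * y^-1).
Proof.
move=> sH Hg Hx <-; apply: sub_gen.
exists x^-1; first exact: subgroupV.
exists g^-1; first exact: subgroupV.
by rewrite /commg /conjg !invgK !invMg invgK !mulgA.
Qed.

(** Additively, [S] gives a = b and [T] gives a + 2b = 0, so 3a = 0; together with 5a = 0 this kills
    a and b. *)
Lemma derived_ST H a b S T : subgroup H -> H a -> H b -> H S -> H T ->
  S * a * S^-1 = b -> T * b * T^-1 = a^-1 * b^-1 ->
  S ^+ 2 = 1 -> (S * T) ^+ 3 = 1 -> T ^+ 2 = a^-1 -> derived H (a ^+ 5) ->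
  [/\ derived H a, derived H b & derived H (S * T)].
Proof.
move=> sH Ha Hb HS HT hS hT S2 ST3 T2 a5.
have sD := subgroup_gen [set [~ u, v] | u in H & v in H].
have Hb' := subgroupV sH Hb.
have Dab := derived_conj_eq sH HS Ha hS.
have Dbba := derived_conj_eq sH HT Hb hT; rewrite invMg !invgK mulgA in Dbba.
have Da3 : derived H (a ^+ 3).
  (* The word is [Dab] taken twice, followed by [Dbba]. *)
  have := @derived_prod_perm _ H [:: a; b^-1; a; b^-1; b; b; a]
    [:: a; a; a; b; b^-1; b; b^-1] sH.
  rewrite /= !asboolT // => /(_ isT); rewrite !big_cons !big_nil => D.
  rewrite !expgS expg0; move: D; rewrite !(mulg1, mulgV); apply.
    by apply/permP=> p /=; lia.
  by have := subgroupM sD (subgroupM sD Dab Dab) Dbba; rewrite -!mulgA.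
have Da : derived H a.
  (* Here a = 6a - 5a. *)
  have := sD.2 _ _ (subgroupM sD Da3 Da3) a5.
  by rewrite -expgnDr (expgS a 5) mulgK.
have Db : derived H b.
  by have := subgroupM sD (subgroupV sD Dab) Da; rewrite invMg invgK mulgVK.
split=> //.
(* The trivial word [(S * T) ^+ 3] is rearranged into [S ^+ 2 * T ^+ 2 * (S * T)], which equals
   [a^-1 * (S * T)]. *)
have := @derived_prod_perm _ H [:: S; T; S; T; S; T]
  [:: S; S; T; T; S; T] sH.
rewrite /= !asboolT // => /(_ isT); rewrite !big_cons !big_nil !mulg1.
rewrite [S * (S * _)]mulgA -expg2 S2 mul1g [T * (T * _)]mulgA -expg2 T2.
have -> : S * (T * (S * (T * (S * T)))) = 1.
  by rewrite -ST3 !expgS expg0 mulg1 -!mulgA.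
move=> /(_ _ sD.1) DST; have := subgroupM sD Da (DST _).
by rewrite mulKVg; apply; apply/permP=> p /=; lia.
Qed.

(** Used with [u = R * S] and [v = S * T]. Additively, a + b = 0 and a + 2b = 0 kill a and b, while
    2v = 0 and 3v = 0 kill v. *)
Lemma derived_dihedral H a b u v : subgroup H -> H a -> H b -> H u -> H v ->
  u * a * u^-1 = b^-1 -> v * b * v^-1 = b^-1 * a^-1 ->
  v ^+ 3 = 1 -> u * v * u^-1 = v^-1 ->
  [/\ derived H a, derived H b & derived H v].
Proof.
move=> sH Ha Hb Hu Hv ha hb v3 hv.
have sD := subgroup_gen [set [~ u, v] | u in H & v in H].
have Dab := derived_conj_eq sH Hu Ha ha; rewrite invgK in Dab.
have Dbab := derived_conj_eq sH Hv Hb hb; rewrite invMg !invgK in Dbab.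
have Db : derived H b by have := sD.2 _ _ Dbab Dab; rewrite mulgK.
have Da : derived H a by have := sD.2 _ _ Dab Db; rewrite mulgK.
have Dvv := derived_conj_eq sH Hu Hv hv; rewrite invgK in Dvv.
split=> //; have Dv3 : derived H (v ^+ 3) by rewrite v3; exact: sD.1.
have := subgroupM sD (sD.2 _ _ sD.1 Dvv) Dv3.
by rewrite mul1g -expg2 (expgSr v 2) mulKg.
Qed.

Lemma invg_expg2 x : x ^+ 2 = 1 -> x^-1 = x.
Proof. by move=> x2; apply: (mulgI x); rewrite mulgV -x2. Qed.

Lemma involutions_expg2 R S g : R ^+ 2 = 1 -> S ^+ 2 = 1 -> (R * S) ^+ 2 = 1 ->
  gen [set R; S] g -> g ^+ 2 = 1.
Proof.
move=> R2 S2 RS2.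
have cRS : commute R S.
  by have := invg_expg2 RS2; rewrite invMg !invg_expg2 // => /esym.
(* Centralizers are subgroups. Applied first to the generators and then to the group they generate,
   this makes that group abelian, so squaring is multiplicative on it. *)
have sC A : subgroup [set x | forall y, A y -> commute x y].
  split=> [y _|x y Cx Cy z Az]; first exact/commute_sym/commute1.
  apply: commute_sym; apply: commuteM; first exact/commute_sym/Cx.
  exact/commuteV/commute_sym/Cy.
have cgen x : gen [set R; S] x -> forall y, [set R; S] y -> commute x y.
  by move: x; apply: (gen_sub (sC _)) => _ [->|->] y [->|->].
have cLL x : gen [set R; S] x -> forall y, gen [set R; S] y -> commute x y.
  by move: x; apply: (gen_sub (sC _)) => x xRS y /cgen cy; exact/commute_sym/cy.
suff: gen [set R; S] `<=` [set x | gen [set R; S] x /\ x ^+ 2 = 1].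
  by move=> h /h[].
apply: gen_sub => [|x xRS]; last by split; [exact: sub_gen | case: xRS => ->].
split=> [|x y [Lx x2] [Ly y2]].
  by split; [exact: (subgroup_gen _).1 | exact: expg1n].
split; first by apply: (subgroup_gen _).2.
by rewrite invg_expg2 // expgMn ?x2 ?y2 ?mulg1 //; apply: cLL.
Qed.

End Abelianizations.

(** * The two orbifold groups inside [GammaO] *)

Theorem proposition3p3
  (RR : realType)
  (k : fieldExtType rat)
  (hk_deg : \dim {:k} = 3%N)
  (hk_disc : field_discriminant k (- 23%:R))
  (B : falgType k) (alpha beta : k) (qi qj : B)
  (hB : quaternion_algebra alpha beta qi qj)
  (hB_ram : forall v : k -> RR, absolute_value v -> nontrivial_abs v ->
     (ramified_at B v <-> real_place v \/ prime_of_norm 5 v))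
  (O : set B) (hO : maximal_order O)
  (sigma : {rmorphism k -> RR[i]}) (hsigma : complex_place sigma)
  (rho : {rmorphism B -> 'M[RR[i]]_2}) (hrho : matrix_splitting sigma rho)
  (GammaO1 GammaO GammaW : set (PSL2 RR[i]))
  (hGammaO1 : GammaO1 = norm_one_group alpha beta qi qj O rho)
  (hGammaO : GammaO = normalizer GammaO1)
  (hGammaW : weeks_group GammaW)
  (hWO : has_index GammaW GammaO 12)
  (hWO_D6 : quotient_iso GammaO GammaW 'D_12)
  (hWO1 : has_index GammaW GammaO1 3)
  (a b R S T : PSL2 RR[i])
  (hab : GammaW = gen [set a; b])
  (hRST : GammaO = gen (GammaW `|` [set R; S; T]))
  (hRa : (R * a * R^-1 = a^-1)%g) (hRb : (R * b * R^-1 = b^-1)%g)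
  (hSa : (S * a * S^-1 = b)%g) (hSb : (S * b * S^-1 = a)%g)
  (hTa : (T * a * T^-1 = a)%g) (hTb : (T * b * T^-1 = a^-1 * b^-1)%g)
  (hR2 : (R ^+ 2 = 1)%g) (hS2 : (S ^+ 2 = 1)%g)
  (hRS2 : ((R * S) ^+ 2 = 1)%g) (hRT2 : ((R * T) ^+ 2 = 1)%g)
  (hST3 : ((S * T) ^+ 3 = 1)%g) (hT2 : (T ^+ 2 = a^-1)%g) :
  derived (gen (GammaW `|` [set S; T])) = GammaO1 /\
  derived (gen (GammaW `|` [set (R * S)%g; (S * T)%g])) = GammaO1.
Proof.
have [sW _ tfW _ [x [y [Wxy xy _]]]] := hGammaW.
have sL : subgroup GammaO by rewrite hRST; exact: subgroup_gen.
have sO1 : subgroup GammaO1.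
  apply: (subgroup_of_finite_index sW _ hWO1); rewrite hGammaO1 => g h.
  exact: norm_one_groupM hB hO.1.
have O1L : GammaO1 `<=` GammaO.
  by rewrite hGammaO; exact: subgroup_sub_normalizer.
have LnO1 : GammaO `<=` normalizer GammaO1 by rewrite hGammaO.
have oD : #|[set: 'D_12]%G| = 12%N := @card_dihedral 6 isT.
have LR : GammaO R by rewrite hRST; apply: sub_gen; right; left; left.
have LS : GammaO S by rewrite hRST; apply: sub_gen; right; left; right.
have LT : GammaO T by rewrite hRST; apply: sub_gen; right; right.
have Wa : GammaW a by rewrite hab; apply: sub_gen; left.
have Wb : GammaW b by rewrite hab; apply: sub_gen; right.
have WST : ~ GammaW (S * T)%g.
  move=> /tfW/(_ hST3) ST1.
  have TS : T = S by apply: (mulgI S); rewrite ST1 -expg2 hS2.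
  have a1 : a = 1%g by rewrite -[a]invgK -hT2 TS hS2 invg1.
  have b1 : b = 1%g by rewrite -hSa a1 mulg1 mulgV.
  have sRS := subgroup_gen [set R; S].
  have WRS : GammaW `<=` gen [set R; S].
    rewrite hab; apply: (gen_sub sRS) => _ [->|->];
      by rewrite ?a1 ?b1; exact: sRS.1.
  have LRS : GammaO `<=` gen [set R; S].
    rewrite hRST; apply: (gen_sub sRS) => g [/WRS//|[[|]|] ->];
      rewrite ?TS; apply: sub_gen; by [left | right].
  (* An element of order 3 in the dihedral quotient contradicts exponent 2. *)
  have [g /LRS RSg] := exists_expg2_notin sL hWO_D6 oD; apply.
  by rewrite (involutions_expg2 hR2 hS2 hRS2 RSg); exact: sW.1.
have O1ST : GammaO1 (S * T)%g.
  apply: (mem_index3_of_expg3 sL sO1 sW O1L LnO1 hWO_D6 oD hWO1) => //.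
  exact: subgroupM.
(* Both halves rest on one squeeze: [derived H] lies in [derived GammaO], hence in [GammaO1], which
   is generated by [a], [b] and [S * T]. *)
have derived_eq H : subgroup H -> H `<=` GammaO -> derived H a -> derived H b ->
    derived H (S * T)%g -> derived H = GammaO1.
  move=> sH HL Da Db DST; apply/seteqP; split.
    move=> g /(derivedS HL).
    exact: (derived_sub_index3 sL sO1 sW O1L LnO1 hWO_D6 oD hWO1).
  move=> g /(index3_gen sL sO1 sW O1L LnO1 hWO_D6 hWO1 O1ST WST); move: g.
  have sD := subgroup_gen [set [~ u, v]%g | u in H & v in H].
  apply: gen_sub => // g [|->] //; rewrite hab.
  by move: g; apply: gen_sub => // _ [->|->].
have WL := hWO.1.
split.
- set H := gen _; have sH : subgroup H by exact: subgroup_gen.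
  have WH g : GammaW g -> H g by move=> Wg; apply: sub_gen; left.
  have HS : H S by apply: sub_gen; right; left.
  have HT : H T by apply: sub_gen; right; right.
  have Hx : H x by apply: WH; rewrite Wxy; apply: sub_gen; left.
  have Hy : H y by apply: WH; rewrite Wxy; apply: sub_gen; right.
  (* [a] is a word in the presenting generators [x] and [y]. *)
  have a5 : derived H (a ^+ 5)%g.
    by apply: weeks_derived_exp5 Hx Hy xy _; rewrite // -Wxy.
  have [Da Db DST] :=
    derived_ST sH (WH _ Wa) (WH _ Wb) HS HT hSa hTb hS2 hST3 hT2 a5.
  apply: derived_eq => //; apply: (gen_sub sL) => g [/WL//|[->|->]] //.
- set H := gen _; have sH : subgroup H by exact: subgroup_gen.
  have WH g : GammaW g -> H g by move=> Wg; apply: sub_gen; left.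
  have HRS : H (R * S)%g by apply: sub_gen; right; left.
  have HST : H (S * T)%g by apply: sub_gen; right; right.
  have hRSa : (R * S * a * (R * S)^-1 = b^-1)%g.
    by rewrite invMg -hRb -hSa !mulgA.
  have hSTb : (S * T * b * (S * T)^-1 = b^-1 * a^-1)%g.
    transitivity (S * (T * b * T^-1) * S^-1)%g; first by rewrite invMg !mulgA.
    rewrite hTb -!invMg; transitivity ((S * (b * a) * S^-1)^-1)%g.
      by rewrite !invMg !invgK !mulgA.
    have -> : (a * b = (S * b * S^-1) * (S * a * S^-1))%g by rewrite hSa hSb.
    by rewrite !mulgA mulgVK.
  (* As [R * T] and [R * S] square to 1, the left side is [R * T * R * S = T^-1 * S]. *)
  have hRSST : (R * S * (S * T) * (R * S)^-1 = (S * T)^-1)%g.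
    have eT : (T^-1 = R * T * R)%g.
      by apply: (mulIg T); rewrite mulVg -hRT2 expg2 mulgA.
    rewrite (invg_expg2 hRS2) invMg (invg_expg2 hS2) eT !mulgA.
    by rewrite -[(R * S * S)%g]mulgA -expg2 hS2 mulg1.
  have [Da Db DST] :=
    derived_dihedral sH (WH _ Wa) (WH _ Wb) HRS HST hRSa hSTb hST3 hRSST.
  apply: derived_eq => //; apply: (gen_sub sL) => g [/WL//|[->|->]];
    exact: subgroupM.
Qed.
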